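(* Assume that there exist constants $a>0$, $K_1\ge1$ and $K_2\ge1$ such that $$\mathbb E\big[\exp\big(a(G_{X_1}(X_1))^2\big)\big]\le K_1\quad\text{and}\quad\mathbb E\big[\exp\big(a(G_\varepsilon(\varepsilon))^2\big)\big]\le K_2.$$ Then there exists a constant $c>0$ depending only on $a,\rho,K_1$ and $K_2$ such that $$\mathbb E[e^{\pm tS_n}]\le\exp(n\,c\,t^2)\quad\text{for all }t>0.$$ Consequently, for any $x>0$, $$\mathbb P(\pm S_n\ge x)\le\exp\left(-\frac{x^2}{4nc}\right).$$
   Context: $(\mathcal X,d)$ and $(\mathcal Y,\delta)$ are complete separable metric spaces; $(\varepsilon_i)_{i\ge1}$ is a sequence of iid $\mathcal Y$-valued random variables; $X_1$ is an $\mathcal X$-valued random variable independent of $(\varepsilon_i)_{i\ge2}$. The Markov chain is $X_n=F(X_{n-1},\varepsilon_n)$ for $n\ge2$, where $F:\mathcal X\times\mathcal Y\to\mathcal X$ is measurable and satisfies, for some $\rho\in[0,1)$ and $C>0$, $\mathbb E[d(F(x,\varepsilon_1),F(x',\varepsilon_1))]\le\rho\,d(x,x')$ for all $x,x'\in\mathcal X$, and $d(F(x,y),F(x,y'))\le C\,\delta(y,y')$ for all $x\in\mathcal X$, $y,y'\in\mathcal Y$. $n\ge1$ and $f:\mathcal X^n\to\mathbb R$ are arbitrary with $|f(x_1,\ldots,x_n)-f(x_1',\ldots,x_n')|\le d(x_1,x_1')+\cdots+d(x_n,x_n')$, and $S_n=f(X_1,\ldots,X_n)-\mathbb E[f(X_1,\ldots,X_n)]$.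 Let $P_{X_1}$ be the law of $X_1$, $P_\varepsilon$ the common law of the $\varepsilon_k$'s, $G_{X_1}(x)=\int d(x,x')P_{X_1}(dx')$, $G_\varepsilon(y)=\int C\,\delta(y,y')P_\varepsilon(dy')$; $G_\varepsilon(\varepsilon)$ denotes a random variable distributed as $G_\varepsilon(\varepsilon_k)$. Statements with $\pm$ hold for each of the two signs. *)

(* Defs.v *)
From HB Require Import structures.
From mathcomp Require Import all_boot all_order all_algebra finmap.
From mathcomp Require Import all_classical all_reals all_analysis.

Set Implicit Arguments.
Unset Strict Implicit.
Unset Printing Implicit Defensive.

Import Order.TTheory GRing.Theory Num.Theory.
Import numFieldNormedType.Exports.

Local Open Scope classical_set_scope.
Local Open Scope ring_scope.

(* The library's complete spaces are pointed. Spaces carrying a random variable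
   are nonempty anyway. *)
#[short(type="completeMetricType")]
HB.structure Definition CompleteMetric (R : numFieldType) :=
  {T of Complete T & Metric R T}.

Definition separable_space (T : topologicalType) : Prop :=
  exists2 D : set T, countable D & dense D.

(* [T] with its Borel sigma-algebra; convertible to [T]. *)
Notation borel T := (g_sigma_algebraType (@open T)).

Section random_variables.
Context d d' (Omega : measurableType d) (T : measurableType d') (R : realType)
  (P : probability Omega R).

Definition mutually_independent (I : choiceType) (X : I -> {RV P >-> T}) : Prop :=
  forall (J : {fset I}) (A : I -> set T), (forall i, i \in J -> measurable (A i)) ->
    P (\bigcap_(i in [set` J]) (X i @^-1` A i)) =
    (\prod_(i <- J) P (X i @^-1` A i))%E.

Definition identically_distributed (I : Type) (X : I -> {RV P >-> T}) : Prop :=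
  forall i j (A : set T), measurable A ->
    distribution P (X i) A = distribution P (X j) A.

Definition sigma_family (I : Type) (X : I -> {RV P >-> T}) : set (set Omega) :=
  <<s \bigcup_i preimage_set_system [set: Omega] (X i) measurable >>.

(* Under the integrability of [Z], [fine] only removes the injection of [R]
   into the extended reals. *)
Definition centered (Z : Omega -> R) : Omega -> R :=
  fun w => Z w - fine 'E_P[Z].

End random_variables.

Definition independent_of_family d d1 d2 (Omega : measurableType d)
    (T1 : measurableType d1) (T2 : measurableType d2) (R : realType)
    (P : probability Omega R) (Z : {RV P >-> T1})
    (I : Type) (X : I -> {RV P >-> T2}) : Prop :=
  forall (A : set T1) (B : set Omega), measurable A -> sigma_family X B ->
    P (Z @^-1` A `&` B) = (P (Z @^-1` A) * P B)%E.

(* Indices are shifted by one: [chain F X1 eps k] is $X_{k+1}$ and [eps k] is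
   $\varepsilon_{k+1}$, so that [eps 0] does not enter the chain. *)
Fixpoint chain (Omega X Y : Type) (F : X * Y -> X) (X1 : Omega -> X)
    (eps : nat -> Omega -> Y) (k : nat) (w : Omega) : X :=
  if k is k'.+1 then F (chain F X1 eps k' w, eps k'.+1 w) else X1 w.

(* $x \mapsto \int C d(x, x') \mu(dx')$, possibly infinite: the integrability of
   the distance is not assumed a priori. *)
Definition mean_dist (R : realType) (X : completeMetricType R)
    (mu : {measure set (borel X) -> \bar R}) (C : R) (x : X) : \bar R :=
  (\int[mu]_x' (C * mdist x (x' : X))%:E)%E.

(* Main.v *)
Require Import Defs.
From HB Require Import structures.
From mathcomp Require Import all_boot all_order all_algebra finmap.
From mathcomp Require Import all_classical all_reals all_analysis.
From mathcomp Require Import measurable_realfun ring lra.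

(** Write X_0, X_1, X_2 and so on for the chain, with indices starting at 0, so that
the X_1 of the statement is X_0 below. The proof is the martingale method:
the coordinates of the chain are integrated out one at a time, from the last
one to the first, and each integration costs a factor exp(c t^2) in the Laplace
transform.

Let kappa = 1 / (1 - rho), and say that g is last-Lipschitz of order k when

  |g x - g x'| <= sum_(i < k) d(x_i, x'_i) + kappa d(x_k, x'_k).

The function f of the statement is last-Lipschitz because kappa >= 1. Replacing
x_(k+1) by F(x_k, y) and averaging over the law of y maps last-Lipschitz
functions of order k + 1 to last-Lipschitz functions of order k: the contraction
in mean turns kappa d(x_(k+1), x'_(k+1)) into kappa rho d(x_k, x'_k), and kappa
is the fixed point of 1 + kappa rho = kappa (average_last_lipschitz).

For a fixed past x, the function y |-> g(x, F(x_k, y)) is Lipschitz for the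
distance kappa C delta, so that its deviation from its mean is at most
kappa G_eps(y). A centered variable D with |D| <= G and
E exp(a G^2) <= K satisfies E exp(t D) <= exp(2 K t^2 / a) for every t
(mgf_le_of_square_exp). Since eps_(k+1) is independent of the past, Fubini's theorem
applied conditionally on the past gives

  E exp(t (g(X_0, .., X_(k+1)) - m)) <= exp(c t^2) E exp(t (g'(X_0, .., X_k) - m))

with g' the averaged function and c = 2 K kappa^2 / a, and both sides have the
same mean m (concentrated_step). After the last averaging, X_0 is treated
in the same way, the mean distance to X_0 replacing G_eps (concentrated_first). The tail
bound is Chernoff's, optimized at t = x / (2 n c).

Measurability of all the functions that occur comes for free from the Lipschitz property:
over a separable space, a Lipschitz function of finitely many measurable maps is
measurable (measurable_fun_lipschitz). Independence is used through the
sigma-algebra generated by the events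
{X_0 in A, eps_1 in E_0, .., eps_k in E_(k-1)}, which form a pi-system. *)

Set Implicit Arguments.
Unset Strict Implicit.
Unset Printing Implicit Defensive.

Import Order.TTheory GRing.Theory Num.Theory.
Import numFieldNormedType.Exports.

Local Open Scope classical_set_scope.
Local Open Scope ring_scope.

(** * Sub-Gaussian bounds from square-exponential moments *)

Section subgaussian.
Context {R : realType}.

(** The linear term is what makes the bound useful: it vanishes on integration of a
centered variable. The factor 2 leaves room for the crude estimate
exp(x) <= 1 / (1 - x), which suffices for x < 1/2; beyond that, x <= 2 x^2. *)
Lemma expR_le_square (x : R) : expR x <= x + expR (2 * x ^+ 2).
Proof.
have [x_lt|x_ge] := ltP x (1 / 2); last first.
  have x_le : x <= 2 * x ^+ 2 by nra.
  have : expR x <= expR (2 * x ^+ 2) by rewrite ler_expR.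
  by move=> ?; lra.
have x_lt1 : 0 < 1 - x by lra.
have e1 : expR x <= (1 - x)^-1.
  rewrite -[x in expR x]opprK expRN lef_pV2 ?posrE ?expR_gt0//.
  exact: (expR_ge1Dx (- x)).
have e2 : (1 - x)^-1 <= 1 + x + 2 * x ^+ 2.
  rewrite -[leLHS]mul1r ler_pdivrMr//.
  have : 0 <= x ^+ 2 * (1 - 2 * x) by apply: mulr_ge0; [exact: sqr_ge0|lra].
  by nra.
have e3 := expR_ge1Dx (2 * x ^+ 2).
by lra.
Qed.

Lemma expR_chord (s u : R) : 0 <= s <= 1 -> expR (s * u) <= (1 - s) + s * expR u.
Proof.
move=> /andP[s0 s1].
have := @convex_expR R (Itv01 s0 s1) u 0.
rewrite !convRE/= mulr0 addr0 expR0 mulr1 addrC.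
rewrite /unstable.onem.
by [].
Qed.

Context d (T : measurableType d) (P : probability T R).

Lemma integrable_affine (D u : T -> R) (b c g : R) :
  P.-integrable setT (EFin \o D) -> P.-integrable setT (EFin \o u) ->
  P.-integrable setT (fun x => (b * D x + c + g * u x)%:E) /\
  (\int[P]_x (b * D x + c + g * u x)%:E =
    b%:E * \int[P]_x (D x)%:E + c%:E + g%:E * \int[P]_x (u x)%:E)%E.
Proof.
move=> iD iu.
have ibD : P.-integrable setT (fun x => b%:E * (D x)%:E)%E by exact: integrableZl.
have igu : P.-integrable setT (fun x => g%:E * (u x)%:E)%E by exact: integrableZl.
have ic : P.-integrable setT (cst c%:E).
  by apply: finite_measure_integrable_cst.
have ibDc := integrableD measurableT ibD ic.
split; first exact: (integrableD measurableT ibDc igu).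
transitivity (\int[P]_x ((b%:E * (D x)%:E + cst c%:E x) + g%:E * (u x)%:E))%E.
  by [].
rewrite integralD// integralD// integralZl// integralZl// integral_cst//.
by rewrite /= probability_setT mule1.
Qed.

(** With s = 2 t^2 / a, there are two regimes. If s <= 1, then
exp(t D) <= t D + exp(s a G^2), and convexity replaces exp(s a G^2) by the chord
(1 - s) + s exp(a G^2), whose integral is at most exp(s (K - 1)). If s > 1, no
centering is needed: t D <= a G^2 + t^2 / (4 a) by the inequality between
geometric and arithmetic means, and the constant K is absorbed by exp(s K). *)
Lemma mgf_le_of_square_exp (D G : T -> R) (a K t : R) :
  0 < a -> 1 <= K -> measurable_fun setT G -> (forall x, `|D x| <= G x) ->
  P.-integrable setT (EFin \o D) -> (\int[P]_x (D x)%:E = 0)%E ->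
  (\int[P]_x (expR (a * G x ^+ 2))%:E <= K%:E)%E ->
  (\int[P]_x (expR (t * D x))%:E <= (expR (2 * K / a * t ^+ 2))%:E)%E.
Proof.
move=> a0 K1 mG DG iD D0 GK; pose u x := expR (a * G x ^+ 2).
have mD : measurable_fun setT D by apply/measurable_EFinP; exact: (measurable_int P iD).
have mu : measurable_fun setT u.
  apply: measurableT_comp => //; apply: measurable_funM => //.
  exact: measurable_funX.
have iu : P.-integrable setT (EFin \o u).
  apply/integrableP; split; first exact/measurable_EFinP.
  under eq_integral do rewrite /= ger0_norm ?expR_ge0//.
  exact: le_lt_trans GK (ltry _).
have mtD : measurable_fun setT (fun x => (expR (t * D x))%:E).
  by apply/measurable_EFinP/measurableT_comp => //; exact: measurable_funM.
have D2G x : D x ^+ 2 <= G x ^+ 2.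
  by rewrite -real_normK ?num_real// lerXn2r ?nnegrE// (le_trans _ (DG x)).
pose s := 2 * t ^+ 2 / a.
have s0 : 0 <= s by rewrite divr_ge0 ?(ltW a0)// mulr_ge0 ?sqr_ge0.
have -> : 2 * K / a * t ^+ 2 = s * K by rewrite /s; field; rewrite ?gt_eqF.
have main b c g : 0 <= g ->
    (forall x, expR (t * D x) <= b * D x + c + g * u x) ->
    (\int[P]_x (expR (t * D x))%:E <= (c + g * K)%:E)%E.
  move=> g0 bnd; have [iaff eaff] := integrable_affine b c g iD iu.
  apply: (@le_trans _ _ (\int[P]_x (b * D x + c + g * u x)%:E)%E).
    apply: ge0_le_integral => //.
    - exact: measurable_int iaff.
    - by move=> x _; rewrite lee_fin.
  rewrite eaff D0 mule0 add0e EFinD EFinM leeD2l//.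
  by apply: lee_wpmul2l => //; rewrite lee_fin.
have [s1|s1] := leP s 1.
  apply: (le_trans (main t (1 - s) s s0 _)) => [x|].
    apply: (le_trans (expR_le_square _)); rewrite -[leRHS]addrA lerD2l.
    apply: (@le_trans _ _ (expR (s * (a * G x ^+ 2)))).
      rewrite ler_expR exprMn.
      have -> : s * (a * G x ^+ 2) = 2 * (t ^+ 2 * G x ^+ 2).
        by rewrite /s; field; rewrite ?gt_eqF.
      by rewrite ler_pM2l// ler_wpM2l ?sqr_ge0.
    by apply: expR_chord; rewrite s0.
  rewrite lee_fin; have := expR_ge1Dx (s * (K - 1)).
  have : expR (s * (K - 1)) <= expR (s * K) by rewrite ler_expR; nra.
  by lra.
apply: (le_trans (main 0 0 (expR (s / 8)) (expR_ge0 _) _)) => [x|].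
  rewrite mul0r !add0r -expRD ler_expR.
  have -> : s / 8 = t ^+ 2 / (4 * a) by rewrite /s; field; rewrite ?gt_eqF.
  have : 0 <= a * (D x - t / (2 * a)) ^+ 2 by rewrite mulr_ge0 ?sqr_ge0 ?(ltW a0).
  have -> : a * (D x - t / (2 * a)) ^+ 2 =
      a * D x ^+ 2 - t * D x + t ^+ 2 / (4 * a) by field; rewrite ?gt_eqF.
  have : a * D x ^+ 2 <= a * G x ^+ 2 by rewrite ler_pM2l.
  by lra.
rewrite add0r lee_fin; apply: (@le_trans _ _ (expR (s / 8) * expR (K - 1))).
  by rewrite ler_pM2l ?expR_gt0//; have := expR_ge1Dx (K - 1); lra.
by rewrite -expRD ler_expR; nra.
Qed.

End subgaussian.

(** * Measurability of Lipschitz functions *)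

Section lipschitz_measurability.
Context {R : realType} (X : completeMetricType R).

Lemma open_mdist_lt (q : X) (r : R) : open [set x : X | mdist x q < r].
Proof.
rewrite openE => x /= xr; apply/nbhs_ballP.
exists (r - mdist x q) => /=; first by rewrite subr_gt0.
move=> y; rewrite ballEmdist /= => xy.
by have := metric_triangle y x q; rewrite (metric_sym y x); lra.
Qed.

Lemma measurable_lipschitz (h : X -> R) (L : R) : 0 <= L ->
  (forall x x', `|h x - h x'| <= L * mdist x x') ->
  measurable_fun [set: borel X] (h : borel X -> R).
Proof.
move=> L0 hL.
apply: (measurability _ (RGenInftyO.measurableE R)) => _ [_ [r ->] <-].
rewrite setTI preimage_itvNyo; apply: sub_sigma_algebra.
rewrite openE => x /= xr; apply/nbhs_ballP.
have L1 : 0 < L + 1 by rewrite ltr_wpDl.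
exists ((r - h x) / (L + 1)) => /=; first by rewrite divr_gt0// subr_gt0.
move=> y; rewrite ballEmdist /= ltr_pdivlMr// => xy.
have := hL x y; rewrite ler_norml => /andP[+ _].
by have := mdist_ge0 x y; lra.
Qed.

Lemma mdist_lipschitz (q x x' : X) : `|mdist x q - mdist x' q| <= mdist x x'.
Proof.
have := metric_triangle x x' q; have := metric_triangle x' x q.
by rewrite (metric_sym x' x) ler_norml; lra.
Qed.

Lemma measurable_mdist (q : X) :
  measurable_fun [set: borel X] (fun x : borel X => mdist (x : X) q).
Proof.
apply: (@measurable_lipschitz (fun x => mdist x q) 1) => // x x'.
by rewrite mul1r mdist_lipschitz.
Qed.

Lemma separable_dense_seq : separable_space X ->
  exists e : nat -> X, forall (x : X) (r : R), 0 < r -> exists n, mdist x (e n) < r.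
Proof.
move=> [D cD dD]; have /pfcard_geP[D0|[e]] := cD.
  have [x [_]] := dD setT (ex_intro _ point I) openT.
  by rewrite D0.
exists e => x r r0.
have xr : [set y : X | mdist y x < r] !=set0 by exists x; rewrite /= mdistxx.
have [y [/= yr Dy]] := dD _ xr (open_mdist_lt x r).
have [n _ en] := @surj _ _ _ _ e _ Dy.
by exists n; rewrite en metric_sym.
Qed.

(** This is where separability enters: the Borel sigma-algebra of a product can be
larger than the product of the Borel sigma-algebras, so that continuity of g
does not suffice. With e a dense sequence,
g(Z) < r holds exactly when g(q) + L sum_i d(Z_i, q_i) < r for some tuple q of
terms of e, and there are countably many tuples. *)
Lemma measurable_fun_lipschitz d (T : measurableType d) (g : (nat -> X) -> R)
    (L : R) (k : nat) (Z : nat -> T -> borel X) :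
  separable_space X -> 0 <= L ->
  (forall x x', `|g x - g x'| <= L * \sum_(i < k) mdist (x i) (x' i)) ->
  (forall i, (i < k)%N -> measurable_fun setT (Z i)) ->
  measurable_fun setT (fun w => g (Z ^~ w)).
Proof.
move=> /separable_dense_seq[e e_dense] L0 gL mZ.
pose q (s : seq nat) i := e (nth 0%N s i).
pose D s w := \sum_(i < k) mdist (Z i w : X) (q s i).
have mD s : measurable_fun setT (D s).
  apply: measurable_sum => i.
  exact: (measurableT_comp (measurable_mdist _) (mZ i (ltn_ord i))).
apply: (measurability _ (RGenInftyO.measurableE R)) => _ [_ [r ->] <-].
rewrite setTI preimage_itvNyo.
rewrite (_ : [set _ | _] = \bigcup_(s : seq nat) [set w | g (q s) + L * D s w < r]).
  apply: countable_bigcupT_measurable; first exact: countableP.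
  move=> s; rewrite -preimage_itvNyo -[X in measurable X]setTI.
  apply: (_ : measurable_fun setT _) => //.
  by apply: measurable_funD => //; exact: measurable_funM.
apply/seteqP; split => w /=; last first.
  move=> [s _ /=]; apply: le_lt_trans.
  by have := gL (Z ^~ w) (q s); rewrite -/(D s w) ler_norml => /andP[]; lra.
move=> gr; pose c := r - g (Z ^~ w); have c0 : 0 < c by rewrite subr_gt0.
(* Replacing Z by a b-close tuple costs at most L k b twice, hence less than c. *)
pose b := c / (2 * L * k%:R + 1).
have b0 : 0 < b by rewrite divr_gt0// ltr_wpDl// !mulr_ge0.
have [n nE] : exists n : nat -> nat, forall i, mdist (Z i w : X) (e (n i)) < b.
  have /choice[n nE] : forall i, exists m, mdist (Z i w : X) (e m) < b.
    by move=> i; exact: e_dense.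
  by exists n.
exists (mkseq n k) => //=.
have Db : D (mkseq n k) w <= k%:R * b.
  rewrite mulr_natl -[X in _ *+ X]card_ord -sumr_const; apply: ler_sum => i _.
  by rewrite /q nth_mkseq// ltW.
have := gL (Z ^~ w) (q (mkseq n k)); rewrite -/(D _ w) ler_norml => /andP[+ _].
have : L * D (mkseq n k) w <= L * (k%:R * b) by rewrite ler_wpM2l.
have : c = (2 * L * k%:R + 1) * b.
  by rewrite /b mulrC divfK// gt_eqF// ltr_wpDl// !mulr_ge0.
by rewrite /c; lra.
Qed.

End lipschitz_measurability.

(** * Integrating out an independent variable *)

Section independence.
Context d (Omega : measurableType d) (R : realType) (P : probability Omega R).

(** Both sides are finite measures in A that agree on the pi-system G. *)
Lemma independent_generated (G : set (set Omega)) (B : set Omega) :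
  G `<=` measurable -> setI_closed G -> G setT -> measurable B ->
  (forall A, G A -> P (A `&` B) = (P A * P B)%E) ->
  forall A, <<s G >> A -> P (A `&` B) = (P A * P B)%E.
Proof.
move=> Gm GI GT mB GB A GA.
have PB : P B = (fine (P B))%:E by rewrite fineK// fin_num_measure.
have PB0 : 0 <= fine (P B) by rewrite fine_ge0.
pose m1 := mrestr P mB.
pose m2 := mscale (NngNum PB0) P.
have : m1 A = m2 A.
  apply: (g_sigma_algebra_measure_unique G Gm (fun=> setT)) => //.
  - exact: bigcup_const.
  - move=> C GC; transitivity (P C * P B)%E; first exact: GB.
    by rewrite {1}PB muleC.
  - move=> _; apply: (le_lt_trans _ (ltry 1)).
    exact/probability_le1/measurableI.
move=> m12; transitivity (m2 A); first exact: m12.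
by rewrite muleC {1}PB.
Qed.

Context d1 d2 (T1 : measurableType d1) (T2 : measurableType d2)
  (Z : {RV P >-> T1}) (V : {RV P >-> T2}).
Hypothesis ZV : forall A B, measurable A -> measurable B ->
  P (Z @^-1` A `&` V @^-1` B) = (P (Z @^-1` A) * P (V @^-1` B))%E.

Let pairing w := (Z w, V w).

Let measurable_pairing : measurable_fun setT pairing.
Proof. by apply: measurable_fun_pair; exact: measurable_funPT. Qed.

Let W : {RV P >-> (T1 * T2)%type} :=
  HB.pack pairing (isMeasurableFun.Build _ _ _ _ _ measurable_pairing).

Let lawW A : measurable A ->
  (distribution P Z \x distribution P V)%E A = distribution P W A.
Proof.
by apply: product_measure_unique => B C mB mC; rewrite /= -ZV.
Qed.

(** Conditioning on Z when V is independent of Z: the law of (Z, V) is the product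
of the two laws, so that Tonelli's theorem integrates V out first. *)
Lemma ge0_integral_independent (h : T1 * T2 -> \bar R) :
  measurable_fun setT h -> (forall z, 0 <= h z)%E ->
  (\int[P]_w h (Z w, V w) =
    \int[P]_w \int[distribution P V]_y h (Z w, y))%E.
Proof.
move=> mh h0.
rewrite -(ge0_integral_distribution W mh h0).
rewrite -(eq_measure_integral _ (fun A mA _ => lawW mA)) fubini_tonelli1//.
rewrite ge0_integral_distribution//; first exact: measurable_fun_fubini_tonelli_F.
by move=> x; exact: integral_ge0.
Qed.

Lemma integrable_independent (h : T1 * T2 -> \bar R) :
  measurable_fun setT h ->
  (\int[P]_w \int[distribution P V]_y `|h (Z w, y)| < +oo)%E ->
  P.-integrable setT (fun w => h (Z w, V w)).
Proof.
move=> mh hoo; apply/integrableP; split.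
  exact: (measurableT_comp mh measurable_pairing).
rewrite (ge0_integral_independent (h := abse \o h))//.
  exact: measurableT_comp.
by move=> z; exact: abse_ge0.
Qed.

Lemma integral_independent (h : T1 * T2 -> \bar R) :
  measurable_fun setT h ->
  (\int[P]_w \int[distribution P V]_y `|h (Z w, y)| < +oo)%E ->
  (\int[P]_w h (Z w, V w) =
    \int[P]_w \int[distribution P V]_y h (Z w, y))%E.
Proof.
move=> mh hoo.
have ih := integrable_independent mh hoo.
have ih' : (distribution P Z \x distribution P V)%E.-integrable setT h.
  apply/integrable12ltyP => //.
  rewrite (ge0_integral_distribution Z)//.
    apply: (measurable_fun_fubini_tonelli_F (abse \o h)) => [|z].
      exact: measurableT_comp.
    exact: abse_ge0.
  by move=> x; exact: integral_ge0.
have mF := measurable_fubini_F ih'.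
transitivity (\int[distribution P W]_z h z)%E.
  by rewrite integral_distribution.
rewrite -(eq_measure_integral _ (fun A mA _ => lawW mA)).
rewrite -integral12_prod_meas1// integral_distribution//.
have /integrableP[_] := integrable_fubini_F ih'.
rewrite (ge0_integral_distribution Z (f := abse \o fubini_F _ h)).
- move=> Foo; apply/integrableP; split => //.
  exact: (measurableT_comp mF).
- exact: measurableT_comp.
- by move=> z; exact: abse_ge0.
Qed.

End independence.

(** * The past of the chain *)

Section history.
Context {R : realType} {d d1 d2 : measure_display} {Omega : measurableType d}
  {S : measurableType d1} {T : measurableType d2} {P : probability Omega R}
  (X1 : {RV P >-> S}) (eps : nat -> {RV P >-> T}).

(** The pi-system of rectangles in the initial state and the first k innovations
that drive the chain. *)
Definition history (k : nat) : set (set Omega) :=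
  [set B | exists A E, [/\ measurable A, forall i, measurable (E i) &
    B = X1 @^-1` A `&` \bigcap_(i in `I_k) (eps i.+1 @^-1` E i)]].

(** The same points as [Omega], but with the information available at time k:
measurability on this type is adaptedness. *)
Definition past k : measurableType _ := g_sigma_algebraType (history k).

Lemma history_setI_closed k : setI_closed (history k).
Proof.
move=> _ _ [A [E [mA mE ->]]] [A' [E' [mA' mE' ->]]].
exists (A `&` A'), (fun i => E i `&` E' i); split.
- exact: measurableI.
- by move=> i; exact: measurableI.
- by rewrite setIACA preimage_setI -bigcapI.
Qed.

Lemma history_setT k : history k setT.
Proof.
exists setT, (fun=> setT); split=> //.
rewrite preimage_setT setTI; apply/esym; rewrite -subTset => w _ i _.
by [].
Qed.

Lemma measurable_innovations k (E : nat -> set T) :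
  (forall i, measurable (E i)) ->
  measurable (\bigcap_(i in `I_k) (eps i.+1 @^-1` E i)).
Proof.
move=> mE; apply: bigcap_measurableType => i _; exact: measurable_funPTI.
Qed.

Lemma history_measurable k : history k `<=` measurable.
Proof.
move=> _ [A [E [mA mE ->]]]; apply: measurableI; first exact: measurable_funPTI.
exact: measurable_innovations.
Qed.

Lemma measurable_past k : measurable_fun setT (id : Omega -> past k).
Proof.
move=> _ B mB; rewrite setTI preimage_id.
by apply: smallest_sub mB; [exact: sigma_algebra_measurable|exact: history_measurable].
Qed.

Definition past_RV k : {RV P >-> past k} :=
  HB.pack (id : Omega -> past k) (isMeasurableFun.Build _ _ _ _ _ (@measurable_past k)).

Lemma measurable_past_X1 k : measurable_fun [set: past k] X1.
Proof.
move=> _ A mA; rewrite setTI; apply: sub_sigma_algebra.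
exists A, (fun=> setT); split=> //.
by rewrite bigcapT// setIT.
Qed.

Lemma measurable_past_eps k i : (i < k)%N -> measurable_fun [set: past k] (eps i.+1).
Proof.
move=> ik _ A mA; rewrite setTI; apply: sub_sigma_algebra.
exists setT, (fun j => if j == i then A else setT); split=> //.
  by move=> j; case: ifP.
rewrite preimage_setT setTI; apply/seteqP; split=> [w Aw j _|w /(_ i ik)] /=.
  by case: ifP => // /eqP ->.
by rewrite eqxx.
Qed.

Hypothesis eps_indep : mutually_independent eps.
Hypothesis X1_indep : independent_of_family X1 (fun k => eps k.+1).

Lemma sigma_family_innovations k (E : nat -> set T) :
  (forall i, measurable (E i)) ->
  sigma_family (fun k => eps k.+1) (\bigcap_(i in `I_k) (eps i.+1 @^-1` E i)).
Proof.
move=> mE; rewrite /sigma_family; set G := (G in <<s G >>).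
apply: (@bigcap_measurableType _ (g_sigma_algebraType G)) => i _.
apply: sub_sigma_algebra; exists i => //; exists (E i) => //.
by rewrite setTI.
Qed.

Lemma innovations_independent k (E : nat -> set T) (C : set T) :
  (forall i, measurable (E i)) -> measurable C ->
  P (\bigcap_(i in `I_k) (eps i.+1 @^-1` E i) `&` eps k.+1 @^-1` C) =
  (P (\bigcap_(i in `I_k) (eps i.+1 @^-1` E i)) * P (eps k.+1 @^-1` C))%E.
Proof.
move=> mE mC.
pose J := [fset i in iota 1 k]%fset.
pose A i := if i == k.+1 then C else E i.-1.
have mA i : measurable (A i) by rewrite /A; case: ifP.
have kJ : k.+1 \notin J by rewrite !inE mem_iota/= add1n ltnn.
have AE i : i \in J -> A i = E i.-1.
  by rewrite /A; case: eqP => // ->; rewrite (negbTE kJ).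
have JE : \bigcap_(i in `I_k) (eps i.+1 @^-1` E i) =
    \bigcap_(i in [set` J]) (eps i @^-1` A i).
  apply/seteqP; split=> w Ew i /=.
    move=> iJ; rewrite AE//; move: iJ; rewrite !inE mem_iota.
    by case: i => // i; rewrite add1n ltnS => /andP[_]; exact: Ew.
  move=> ik; have iJ : i.+1 \in J by rewrite !inE mem_iota add1n ltnS.
  by have := Ew _ iJ; rewrite /= AE.
have -> : eps k.+1 @^-1` C = eps k.+1 @^-1` A k.+1 by rewrite /A eqxx.
rewrite JE (eps_indep (J := J))//.
rewrite (_ : _ `&` _ = \bigcap_(i in [set` (k.+1 |` J)%fset]) (eps i @^-1` A i)).
  by rewrite eps_indep// big_fsetU1//= muleC.
rewrite setIC; apply/seteqP; split=> w.
  by move=> [/= Aw JAw] i /=; rewrite in_fset1U => /predU1P[->//|iJ]; exact: JAw.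
move=> JAw; split; first by apply: (JAw k.+1); rewrite /= in_fset1U eqxx.
by move=> i iJ; apply: JAw; rewrite /= in_fset1U iJ orbT.
Qed.

(** On the generating rectangles, the independence of [X1] from all the innovations
separates [X1], and the mutual independence separates the last innovation. *)
Lemma past_independent k A C : measurable A -> measurable C ->
  P (past_RV k @^-1` A `&` eps k.+1 @^-1` C) =
  (P (past_RV k @^-1` A) * P (eps k.+1 @^-1` C))%E.
Proof.
move=> mA mC; rewrite preimage_id.
apply: (independent_generated (@history_measurable k)) => //.
- exact: history_setI_closed.
- exact: history_setT.
- exact: measurable_funPTI.
move=> _ [B [E [mB mE ->]]].
have EC : \bigcap_(i in `I_k) (eps i.+1 @^-1` E i) `&` eps k.+1 @^-1` C =
    \bigcap_(i in `I_k.+1) (eps i.+1 @^-1` (if i == k then C else E i)).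
  apply/seteqP; split=> w.
    move=> [Ew Cw] i /= ik; case: eqP => [->//|/eqP ik'].
    by apply: Ew; rewrite /= ltn_neqAle ik'.
  move=> Ew; split.
    move=> i /= ik; have := Ew i (ltnW ik).
    by rewrite /= (ltn_eqF ik).
  by have := Ew k (ltnSn k); rewrite /= eqxx.
rewrite [P (_ `&` \bigcap_(i in _) _)]X1_indep//; last first.
  exact: sigma_family_innovations.
rewrite -muleA -innovations_independent// -setIA X1_indep// EC.
by apply: sigma_family_innovations => i; case: ifP.
Qed.

End history.

(** * Lipschitz functions and the mean distance *)

Section mean_dist.
Context {R : realType} (Y : completeMetricType R) (mu : probability (borel Y) R) (C : R).
Hypothesis C_ge0 : 0 <= C.
Hypothesis mean_dist_fin : exists y, (mean_dist mu C y < +oo)%E.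

Let measurable_mdistr (y : Y) :
  measurable_fun [set: borel Y] (fun y' : borel Y => C * mdist y (y' : Y)).
Proof.
apply: measurable_funM => //.
rewrite (_ : mdist y = fun y' : borel Y => mdist (y' : Y) y).
  exact: measurable_mdist.
by apply/funext => y'; rewrite metric_sym.
Qed.

(** By the triangle inequality, one point at finite mean distance puts all points
at finite mean distance. *)
Lemma integrable_mdist (y : Y) :
  mu.-integrable setT (fun y' => (C * mdist y (y' : Y))%:E).
Proof.
have [y0 y0oo] := mean_dist_fin.
have iy0 : mu.-integrable setT (fun y' => (C * mdist y0 (y' : Y))%:E).
  apply/integrableP; split; first exact/measurable_EFinP.
  under eq_integral do rewrite /= ger0_norm ?mulr_ge0 ?mdist_ge0//.
  exact: y0oo.
have ic : mu.-integrable setT (cst (C * mdist y y0)%:E).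
  exact: finite_measure_integrable_cst.
apply: le_integrable (integrableD measurableT ic iy0) => //.
  exact/measurable_EFinP.
move=> y' _; rewrite lee_fin/= !ger0_norm ?addr_ge0 ?mulr_ge0 ?mdist_ge0//.
by rewrite -mulrDr ler_wpM2l// metric_triangle.
Qed.

Definition mean_distR (y : Y) : R := \int[mu]_(y' in setT) (C * mdist y (y' : Y)).

Lemma mean_distE (y : Y) : mean_dist mu C y = (mean_distR y)%:E.
Proof.
rewrite /mean_distR /Rintegral fineK//.
exact: integrable_fin_num (integrable_mdist y).
Qed.

Lemma mean_distR_lipschitz (y y' : Y) :
  `|mean_distR y - mean_distR y'| <= C * mdist y y'.
Proof.
rewrite /mean_distR -RintegralB//; [|exact: integrable_mdist..].
have iD := integrableB measurableT (integrable_mdist y) (integrable_mdist y').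
apply: (le_trans (le_normr_Rintegral _ _)) => //.
have <- : \int[mu]_(z in setT) (cst (C * mdist y y') z) = C * mdist y y'.
  by rewrite Rintegral_cst//= probability_setT mulr1.
apply: le_Rintegral => //.
- exact: integrable_norm iD.
- exact: finite_measure_integrable_cst.
move=> z _ /=; rewrite -mulrBr normrM ger0_norm// ler_wpM2l//.
exact: mdist_lipschitz.
Qed.

Lemma measurable_mean_distR : measurable_fun [set: borel Y] (mean_distR : borel Y -> R).
Proof. exact: measurable_lipschitz C_ge0 mean_distR_lipschitz. Qed.

Variables (a K : R).
Hypotheses (a_gt0 : 0 < a) (K_ge1 : 1 <= K).
Hypothesis exp_mean_dist : (\int[mu]_y expeR (a%:E * mean_dist mu C y ^+ 2) <= K%:E)%E.

Variables (h : Y -> R) (L : R).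
Hypotheses (L_gt0 : 0 < L) (hL : forall y y', `|h y - h y'| <= L * (C * mdist y y')).

Let mh : measurable_fun [set: borel Y] (h : borel Y -> R).
Proof.
apply: (@measurable_lipschitz _ _ h (L * C)); first by rewrite mulr_ge0// ltW.
by move=> y y'; rewrite -mulrA.
Qed.

Lemma integrable_lipschitz : mu.-integrable setT (EFin \o h).
Proof.
have id := integrableZl measurableT L (integrable_mdist point).
have ic : mu.-integrable setT (cst `|h point|%:E).
  exact: finite_measure_integrable_cst.
apply: le_integrable (integrableD measurableT ic id) => //.
  exact/measurable_EFinP.
move=> y _; rewrite lee_fin/=.
rewrite [leRHS]ger0_norm ?addr_ge0// ?mulr_ge0 ?mdist_ge0 ?(ltW L_gt0)//.
have := hL point y; rewrite distrC.
by have := ler_normD (h y - h point) (h point); rewrite subrK; lra.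
Qed.

Let m := \int[mu]_(y in setT) h y.

(** The deviation from the mean is the average of h y - h y' over y'. *)
Lemma dist_mean_le (y : Y) : `|h y - m| <= L * mean_distR y.
Proof.
have ic : mu.-integrable setT (EFin \o cst (h y)).
  exact: finite_measure_integrable_cst.
have -> : h y - m = \int[mu]_(y' in setT) (cst (h y) y' - h y').
  rewrite RintegralB//; last exact: integrable_lipschitz.
  by rewrite Rintegral_cst//= probability_setT mulr1.
have iD := integrableB measurableT ic integrable_lipschitz.
apply: (le_trans (le_normr_Rintegral _ _)) => //.
rewrite /mean_distR -RintegralZl//; last exact: integrable_mdist.
apply: le_Rintegral => //.
- exact: integrable_norm iD.
- exact: (integrableZl measurableT L (integrable_mdist y)).
- by move=> y' _; exact: hL.
Qed.

Lemma mgf_lipschitz (t : R) :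
  (\int[mu]_y (expR (t * (h y - m)))%:E <=
    (expR (2 * K * L ^+ 2 / a * t ^+ 2))%:E)%E.
Proof.
have ic : mu.-integrable setT (EFin \o cst m).
  exact: finite_measure_integrable_cst.
have -> : 2 * K * L ^+ 2 / a * t ^+ 2 = 2 * K / (a / L ^+ 2) * t ^+ 2.
  by field; rewrite ?gt_eqF.
apply: (mgf_le_of_square_exp (P := mu) (D := fun y => h y - m)
  (G := fun y => L * mean_distR y)) => //.
- by rewrite divr_gt0 ?exprn_gt0.
- apply: measurable_funM => //; exact: measurable_mean_distR.
- exact: dist_mean_le.
- exact: (integrableB measurableT integrable_lipschitz ic).
- under eq_integral do rewrite EFinB.
  rewrite (integralB measurableT integrable_lipschitz ic).
  rewrite (integral_cst mu measurableT m%:E)/= probability_setT mule1.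
  have hfin := integrable_fin_num measurableT integrable_lipschitz.
  by rewrite /m /Rintegral fineK ?subee.
- apply: le_trans exp_mean_dist; rewrite le_eqVlt; apply/orP; left; apply/eqP.
  apply: eq_integral => y _; rewrite mean_distE/=; congr (expR _)%:E.
  by rewrite exprMn; field; rewrite ?gt_eqF.
Qed.

(** From |u| <= exp(u) + exp(- u). The bound depends on h only through L, so that the
conditional deviations of a martingale are bounded in L^1 uniformly in the past. *)
Lemma integral_abs_dev_lipschitz :
  (\int[mu]_y `|h y - m|%:E <= (2 * expR (2 * K * L ^+ 2 / a))%:E)%E.
Proof.
have mD t : measurable_fun setT (fun y : borel Y => (expR (t * (h y - m)))%:E).
  apply/measurable_EFinP/measurableT_comp => //.
  by apply: measurable_funM => //; exact: measurable_funB.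
apply: (@le_trans _ _ (\int[mu]_y ((expR (1 * (h y - m)))%:E +
    (expR (- 1 * (h y - m)))%:E))%E).
  apply: ge0_le_integral => //.
  - by apply/measurable_EFinP/measurableT_comp => //; exact: measurable_funB.
  - exact: emeasurable_funD.
  - move=> y _; rewrite -EFinD lee_fin mul1r mulN1r.
    have := expR_ge1Dx (h y - m); have := expR_ge1Dx (- (h y - m)).
    have := expR_gt0 (h y - m); have := expR_gt0 (- (h y - m)).
    by rewrite ler_norml; lra.
rewrite ge0_integralD// mulr_natl mulr2n EFinD.
apply: leeD; apply: (le_trans (mgf_lipschitz _)); rewrite lee_fin ler_expR.
  by rewrite expr1n mulr1.
by rewrite sqrrN expr1n mulr1.
Qed.

End mean_dist.

(** * Averaging out the innovations one by one *)

(** The mean distance is finite at some point since the exponential moment would be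
infinite otherwise. Finiteness also makes the mean distance Lipschitz, hence
measurable, which is what the change of variables requires. *)
Lemma exp_mean_dist_law {R : realType} (Y : completeMetricType R) d
    (Omega : measurableType d) (P : probability Omega R)
    (V : {RV P >-> borel Y}) (C a K : R) : 0 <= C -> 0 < a ->
  (\int[P]_w expeR (a%:E * mean_dist (distribution P V) C (V w) ^+ 2) <= K%:E)%E ->
  (exists y, mean_dist (distribution P V) C y < +oo)%E /\
  (\int[distribution P V]_y expeR (a%:E * mean_dist (distribution P V) C y ^+ 2)
    <= K%:E)%E.
Proof.
move=> C0 a0 VK.
have V_fin : exists y, (mean_dist (distribution P V) C y < +oo)%E.
  apply: contrapT => /forallNP Voo.
  move: VK; rewrite (eq_integral (cst +oo%E)); last first.
    move=> w _; have /negP := Voo (V w); rewrite -leNgt leye_eq => /eqP ->.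
    by rewrite expe2 mulyy gt0_muley ?lte_fin.
  by rewrite integral_cst//= probability_setT mule1.
split=> //; move: VK; rewrite ge0_integral_distribution//.
  rewrite (_ : (fun _ => _) = (fun y : borel Y =>
    (expR (a * mean_distR (distribution P V) C y ^+ 2))%:E)).
    apply/measurable_EFinP/measurableT_comp => //.
    apply: measurable_funM => //; apply: measurable_funX.
    exact: measurable_mean_distR.
  by apply/funext => y; rewrite mean_distE.
by move=> y; exact: expeR_ge0.
Qed.

Lemma measurable_mdist_lipschitz {R : realType} (X Y : completeMetricType R)
    (u v : Y -> X) (C : R) : 0 <= C ->
  (forall y y', mdist (u y) (u y') <= C * mdist y y') ->
  (forall y y', mdist (v y) (v y') <= C * mdist y y') ->
  measurable_fun [set: borel Y] (fun y : borel Y => mdist (u y) (v y)).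
Proof.
move=> C0 uL vL.
apply: (@measurable_lipschitz _ _ (fun y => mdist (u y) (v y)) (2 * C)).
  by rewrite mulr_ge0.
move=> y y'.
have /ler_normlP[? ?] := mdist_lipschitz (v y) (u y) (u y').
have := mdist_lipschitz (u y') (v y) (v y').
rewrite !(metric_sym _ (u y')) => /ler_normlP[? ?].
have := uL y y'; have := vL y y'.
by move=> ? ?; apply/ler_normlP; split; lra.
Qed.

Section chain.
Context {R : realType} (X Y : completeMetricType R) {d : measure_display}
  {Omega : measurableType d} {P : probability Omega R}
  (X1 : {RV P >-> borel X}) (eps : nat -> {RV P >-> borel Y})
  (F : X * Y -> X) (C a rho K : R).
Hypotheses (sepX : separable_space X)
  (eps_indep : mutually_independent eps)
  (eps_id : identically_distributed eps)
  (X1_indep : independent_of_family X1 (fun k => eps k.+1))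
  (mF : measurable_fun [set: borel X * borel Y] (F : borel X * borel Y -> borel X)).

Let mu := distribution P (eps 0%N).
Let Xs i w : borel X := chain F X1 eps i w.

Lemma measurable_chain k i : (i <= k)%N ->
  measurable_fun [set: past X1 eps k] (Xs i : past X1 eps k -> borel X).
Proof.
elim: i => [|i IH] ik; first exact: measurable_past_X1.
apply: (measurableT_comp mF); apply: measurable_fun_pair.
  exact: IH (ltnW ik).
exact: measurable_past_eps.
Qed.

Lemma ge0_integral_innovation k (h : past X1 eps k * borel Y -> \bar R) :
  measurable_fun setT h -> (forall z, 0 <= h z)%E ->
  (\int[P]_w h (w, eps k.+1 w) = \int[P]_w \int[mu]_y h (w, y))%E.
Proof.
move=> mh h0.
rewrite (ge0_integral_independent (past_independent eps_indep X1_indep (k := k)) mh h0).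
apply: eq_integral => w _; apply: eq_measure_integral => A mA _.
exact: eps_id.
Qed.

Lemma integrable_innovation k (h : past X1 eps k * borel Y -> \bar R) :
  measurable_fun setT h -> (\int[P]_w \int[mu]_y `|h (w, y)| < +oo)%E ->
  P.-integrable setT (fun w => h (w, eps k.+1 w)).
Proof.
move=> mh hoo.
apply: (integrable_independent (past_independent eps_indep X1_indep (k := k)) mh).
rewrite (eq_integral (fun w : Omega => \int[mu]_y `|h (w, y)|)%E)// => w _.
by apply: eq_measure_integral => A mA _; exact: eps_id.
Qed.

Lemma integral_innovation k (h : past X1 eps k * borel Y -> \bar R) :
  measurable_fun setT h -> (\int[P]_w \int[mu]_y `|h (w, y)| < +oo)%E ->
  (\int[P]_w h (w, eps k.+1 w) = \int[P]_w \int[mu]_y h (w, y))%E.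
Proof.
move=> mh hoo.
rewrite (integral_independent (past_independent eps_indep X1_indep (k := k)) mh).
  apply: eq_integral => w _; apply: eq_measure_integral => A mA _.
  exact: eps_id.
rewrite (eq_integral (fun w : Omega => \int[mu]_y `|h (w, y)|)%E)// => w _.
by apply: eq_measure_integral => A mA _; exact: eps_id.
Qed.

Hypotheses (a_gt0 : 0 < a) (rho_ge0 : 0 <= rho) (rho_lt1 : rho < 1)
  (C_ge0 : 0 <= C) (K_ge1 : 1 <= K).
Hypothesis F_contract : forall x x' : X,
  (\int[mu]_y (mdist (F (x, y)) (F (x', y)))%:E <= (rho * mdist x x')%:E)%E.
Hypothesis F_lipschitz : forall (x : X) (y y' : Y),
  mdist (F (x, y)) (F (x, y')) <= C * mdist y y'.

Let kappa := (1 - rho)^-1.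

Let kappa_ge1 : 1 <= kappa.
Proof. by rewrite invf_ge1 ?subr_gt0// gerBl. Qed.

Let kappa_gt0 : 0 < kappa. Proof. exact: lt_le_trans kappa_ge1. Qed.

Let kappa_fix : 1 + kappa * rho = kappa.
Proof. by rewrite /kappa; field; rewrite subr_eq0 gt_eqF. Qed.

(** The last coordinate carries the whole influence of the future of the chain:
weights 1, .., 1, kappa are stable under averaging out the last step. *)
Definition last_lipschitz (k : nat) (g : (nat -> X) -> R) :=
  forall x x', `|g x - g x'| <=
    \sum_(i < k) mdist (x i) (x' i) + kappa * mdist (x k) (x' k).

(** Trajectories are infinite sequences of which only finitely many terms matter,
so that no dependent type records their length. *)
Definition append k (x : nat -> X) (y : Y) : nat -> X :=
  fun i => if i == k.+1 then F (x k, y) else x i.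

Definition average_last k (g : (nat -> X) -> R) (x : nat -> X) : R :=
  \int[mu]_(y in setT) g (append k x y).

Lemma measurable_last_lipschitz k g d' (T : measurableType d')
    (Z : nat -> T -> borel X) : last_lipschitz k g ->
  (forall i, (i <= k)%N -> measurable_fun setT (Z i)) ->
  measurable_fun setT (fun w => g (Z ^~ w)).
Proof.
move=> gL mZ; apply: (@measurable_fun_lipschitz _ _ _ _ g kappa k.+1) => //.
  exact: ltW.
move=> x x'; apply: (le_trans (gL x x')).
rewrite big_ord_recr/= mulrDr lerD2r ler_peMl// sumr_ge0// => i _.
exact: mdist_ge0.
Qed.

Lemma append_lipschitz k g x y y' : last_lipschitz k.+1 g ->
  `|g (append k x y) - g (append k x y')| <= kappa * (C * mdist y y').
Proof.
move=> gL; apply: (le_trans (gL _ _)).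
rewrite big1 ?add0r => [|i _]; last by rewrite /append ltn_eqF// mdistxx.
by rewrite /append eqxx ler_pM2l.
Qed.

Hypothesis mu_fin : exists y, (mean_dist mu C y < +oo)%E.

Let integrable_append k g x : last_lipschitz k.+1 g ->
  mu.-integrable setT (fun y => (g (append k x y))%:E).
Proof.
move=> gL.
apply: (integrable_lipschitz (h := fun y => g (append k x y)) C_ge0 mu_fin kappa_gt0).
by move=> y y'; exact: append_lipschitz.
Qed.

Let integrable_contract (x x' : X) :
  mu.-integrable setT (fun y => (mdist (F (x, y)) (F (x', y)))%:E).
Proof.
apply/integrableP; split; last first.
  under eq_integral do rewrite /= ger0_norm ?mdist_ge0//.
  exact: le_lt_trans (F_contract x x') (ltry _).
apply/measurable_EFinP.
exact: (measurable_mdist_lipschitz C_ge0 (F_lipschitz x) (F_lipschitz x')).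
Qed.

(** The contraction in mean turns the weight kappa of coordinate k.+1 into a weight
kappa rho on coordinate k, which adds up with the weight 1 already there to
1 + kappa rho = kappa. *)
Lemma average_last_lipschitz k g : last_lipschitz k.+1 g ->
  last_lipschitz k (average_last k g).
Proof.
move=> gL x x'.
have ix := integrable_append x gL; have ix' := integrable_append x' gL.
rewrite /average_last -RintegralB//.
apply: (le_trans (le_normr_Rintegral _ _)) => //.
  exact: (integrableB measurableT ix ix').
set S := \sum_(i < k) _.
have iS : mu.-integrable setT (EFin \o cst (S + mdist (x k) (x' k))).
  exact: finite_measure_integrable_cst.
have iF := integrableZl measurableT kappa (integrable_contract (x k) (x' k)).
apply: (@le_trans _ _ (\int[mu]_(y in setT) (cst (S + mdist (x k) (x' k)) y +
    kappa * mdist (F (x k, y)) (F (x' k, y))))).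
  apply: le_Rintegral => //.
  - exact: integrable_norm (integrableB measurableT ix ix').
  - exact: (integrableD measurableT iS iF).
  move=> y _; apply: (le_trans (gL _ _)).
  rewrite big_ord_recr/= /append eqxx !ltn_eqF// lerD2r lerD2r.
  by apply: ler_sum => i _; rewrite ltn_eqF// ltnS ltnW.
rewrite RintegralD// Rintegral_cst//= probability_setT mulr1 RintegralZl//.
rewrite -addrA lerD2l -[in leRHS]kappa_fix mulrDl mul1r lerD2l -mulrA ler_pM2l//.
rewrite -lee_fin /Rintegral fineK//.
exact: integrable_fin_num (integrable_contract _ _).
exact: integrable_contract.
Qed.

Hypothesis mu_exp : (\int[mu]_y expeR (a%:E * mean_dist mu C y ^+ 2) <= K%:E)%E.
Hypothesis mu1_fin : exists x, (mean_dist (distribution P X1) 1 x < +oo)%E.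
Hypothesis mu1_exp : (\int[distribution P X1]_x
  expeR (a%:E * mean_dist (distribution P X1) 1 x ^+ 2) <= K%:E)%E.

Let c := 2 * K * kappa ^+ 2 / a.

Definition concentrated (k : nat) (g : (nat -> X) -> R) (m : R) :=
  [/\ P.-integrable setT (fun w => (g (Xs ^~ w))%:E),
      (\int[P]_w (g (Xs ^~ w))%:E = m%:E)%E &
      forall t, (\int[P]_w (expR (t * (g (Xs ^~ w) - m)))%:E <=
        (expR (k.+1%:R * c * t ^+ 2))%:E)%E].

Lemma concentrated_first g : last_lipschitz 0 g -> exists m, concentrated 0 g m.
Proof.
move=> gL; pose h (x : X) := g (fun=> x).
have hL x x' : `|h x - h x'| <= kappa * (1 * mdist x x').
  by apply: (le_trans (gL _ _)); rewrite big_ord0 add0r mul1r.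
have ih := integrable_lipschitz ler01 mu1_fin kappa_gt0 hL.
have mh : measurable_fun setT (h : borel X -> R).
  by apply/measurable_EFinP; exact: (measurable_int _ ih).
(* Order 0 means that g depends on the first coordinate only. *)
have gE w : g (Xs ^~ w) = h (X1 w).
  apply/eqP; rewrite -subr_eq0 -normr_le0; apply: (le_trans (gL _ _)).
  by rewrite big_ord0 /Xs/= mdistxx mulr0 addr0.
pose m := \int[distribution P X1]_(x in setT) h x.
have ihX : P.-integrable setT (EFin \o h \o X1).
  apply/integrableP; split.
    by apply/measurable_EFinP; exact: measurableT_comp.
  have /integrableP[_] := ih.
  by rewrite ge0_integral_distribution//; exact/measurable_EFinP/measurableT_comp.
exists m; split.
- by under eq_fun do rewrite gE.
- under eq_integral do rewrite gE.
  rewrite /m /Rintegral fineK; last exact: integrable_fin_num ih.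
  by rewrite (integral_distribution (X := X1) _ ihX)//; exact/measurable_EFinP.
- move=> t; under eq_integral do rewrite gE.
  have := mgf_lipschitz ler01 mu1_fin a_gt0 K_ge1 mu1_exp kappa_gt0 hL t.
  rewrite ge0_integral_distribution/=.
  + by rewrite mul1r.
  + apply/measurable_EFinP/measurableT_comp => //.
    by apply: measurable_funM => //; exact: measurable_funB.
  + by move=> x; rewrite lee_fin expR_ge0.
Qed.

(** The increment of the martingale has mean zero and is sub-Gaussian for every fixed
past, with a constant that does not depend on the past. Integrating the last
innovation out therefore keeps the mean and costs a factor exp(c t^2). *)
Lemma concentrated_step k g m : last_lipschitz k.+1 g ->
  concentrated k (average_last k g) m -> concentrated k.+1 g m.
Proof.
move=> gL [iavg Eavg mgf_avg].
pose avg w := average_last k g (Xs ^~ w).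
pose h (z : past X1 eps k * borel Y) := g (append k (Xs ^~ z.1) z.2).
have mh : measurable_fun setT h.
  pose Z i (z : past X1 eps k * borel Y) : borel X :=
    if i == k.+1 then F (Xs k z.1, z.2) else Xs i z.1.
  apply: (measurable_last_lipschitz (Z := Z) gL) => i ik.
  rewrite /Z; case: eqP => [_|/eqP ik1].
    apply: (measurableT_comp mF); apply: measurable_fun_pair => //.
    exact: measurableT_comp (measurable_chain (leqnn k)) measurable_fst.
  apply: (measurableT_comp (measurable_chain _)) => //.
  by rewrite -ltnS ltn_neqAle ik1.
have mavg : measurable_fun [set: past X1 eps k] avg.
  apply: measurable_last_lipschitz (average_last_lipschitz gL) _ => i.
  exact: measurable_chain.
have hE w : g (Xs ^~ w) = h (w, eps k.+1 w).
  congr g; apply/funext => i; rewrite /append.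
  by case: eqP => // ->.
pose D z := h z - avg z.1.
have mD : measurable_fun setT D.
  by apply: measurable_funB => //; exact: measurableT_comp.
have hL w y y' : `|h (w, y) - h (w, y')| <= kappa * (C * mdist y y').
  exact: append_lipschitz.
have Doo : (\int[P]_w \int[mu]_y `|(D (w, y))%:E| < +oo)%E.
  apply: (@le_lt_trans _ _ (\int[P]_w (cst (2 * expR c)%:E w))%E).
    apply: ge0_le_integral => //.
    - by move=> w _; exact: integral_ge0.
    - have mI : measurable_fun setT (fubini_F mu (abse \o (EFin \o D))).
        apply: measurable_fun_fubini_tonelli_F => [|z]; last exact: abse_ge0.
        exact/measurableT_comp/measurable_EFinP.
      exact: (measurableT_comp mI (measurable_funPT (past_RV X1 eps k))).
    - move=> w _.
      exact: (integral_abs_dev_lipschitz C_ge0 mu_fin a_gt0 K_ge1 mu_exp kappa_gt0 (hL w)).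
  by rewrite integral_cst//= probability_setT mule1 ltry.
have mDE : measurable_fun setT (EFin \o D) by exact/measurable_EFinP.
have iD := integrable_innovation mDE Doo.
have ED : (\int[P]_w (D (w, eps k.+1 w))%:E = 0)%E.
  rewrite (integral_innovation mDE Doo).
  apply: integral0_eq => w _.
  rewrite /D/=.
  have ih := integrable_append (Xs ^~ w) gL.
  have ic : mu.-integrable setT (EFin \o cst (avg w)).
    exact: finite_measure_integrable_cst.
  under eq_integral do rewrite EFinB.
  rewrite (integralB measurableT ih ic).
  rewrite (integral_cst mu measurableT (avg w)%:E)/= probability_setT mule1.
  rewrite /avg /average_last /Rintegral fineK ?subee//.
    exact: integrable_fin_num ih.
  exact: integrable_fin_num ih.
have gD w : (g (Xs ^~ w))%:E = ((avg w)%:E + (D (w, eps k.+1 w))%:E)%E.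
  by rewrite hE -EFinD /D subrKC.
split.
- by under eq_fun do rewrite gD; exact: (integrableD measurableT iavg iD).
- under eq_integral do rewrite gD.
  by rewrite (integralD measurableT iavg iD) ED adde0.
move=> t.
have mexp : measurable_fun setT (fun z => (expR (t * (h z - m)))%:E).
  apply/measurable_EFinP/measurableT_comp => //.
  by apply: measurable_funM => //; exact: measurable_funB.
under eq_integral do rewrite hE.
rewrite (ge0_integral_innovation mexp); last first.
  by move=> z; rewrite lee_fin expR_ge0.
have mavgP : measurable_fun [set: Omega] (fun w => (expR (t * (avg w - m)))%:E).
  apply/measurable_EFinP/measurableT_comp => //.
  apply: measurable_funM => //; apply: measurable_funB => //.
  exact: (measurableT_comp mavg (measurable_funPT (past_RV X1 eps k))).
apply: (@le_trans _ _ (\int[P]_w ((expR (c * t ^+ 2))%:E *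
    (expR (t * (avg w - m)))%:E))%E).
  apply: ge0_le_integral => //.
  - move=> w _; apply: integral_ge0 => y _; rewrite lee_fin; exact: expR_ge0.
  - have mI : measurable_fun setT (fubini_F mu (fun z => (expR (t * (h z - m)))%:E)).
      apply: measurable_fun_fubini_tonelli_F => [|z]; first exact: mexp.
      by rewrite /= lee_fin expR_ge0.
    exact: (measurableT_comp mI (measurable_funPT (past_RV X1 eps k))).
  - exact: measurable_funeM.
  move=> w _.
  have mdev : measurable_fun setT
      (fun y : borel Y => (expR (t * (h (w, y) - avg w)))%:E).
    apply/measurable_EFinP/measurableT_comp => //.
    apply: measurable_funM => //; apply: measurable_funB => //.
exact: (measurableT_comp mh (pair1_measurable (w : past X1 eps k))).
  rewrite (eq_integral (fun y => (expR (t * (avg w - m)))%:E *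
      (expR (t * (h (w, y) - avg w)))%:E)%E); last first.
    by move=> y _; rewrite -EFinM -expRD; congr (expR _)%:E; ring.
  rewrite ge0_integralZl//.
  rewrite muleC lee_pmul2r ?lte_fin ?expR_gt0//.
  exact: (mgf_lipschitz C_ge0 mu_fin a_gt0 K_ge1 mu_exp kappa_gt0 (hL w)).
rewrite ge0_integralZl ?lee_fin ?expR_ge0//.
apply: (@le_trans _ _ ((expR (c * t ^+ 2))%:E *
    (expR (k.+1%:R * c * t ^+ 2))%:E)%E).
  by rewrite lee_pmul2l ?lte_fin ?expR_gt0//; exact: mgf_avg.
rewrite -EFinM -expRD lee_fin ler_expR -[X in _ <= X%:R * _ * _]addn1 natrD.
by lra.
Qed.

Lemma chain_concentrated k g : last_lipschitz k g -> exists m, concentrated k g m.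
Proof.
elim: k g => [|k IH] g gL; first exact: concentrated_first.
have [m gm] := IH _ (average_last_lipschitz gL).
by exists m; exact: concentrated_step.
Qed.

End chain.

(** * Tail bound and conclusion *)

(** Chernoff's bound, at the minimizer t = x / (2 v) of v t^2 - t x. *)
Lemma tail_le_of_mgf {R : realType} d (Omega : measurableType d)
    (P : probability Omega R) (S : Omega -> R) (v x : R) :
  measurable_fun setT S -> 0 < v -> 0 < x ->
  (forall t, 0 < t -> (\int[P]_w (expR (t * S w))%:E <= (expR (v * t ^+ 2))%:E)%E) ->
  (P [set w | (x <= S w)%R] <= (expR (- (x ^+ 2 / (4 * v))))%:E)%E.
Proof.
move=> mS v0 x0 mgfS.
pose S' : {RV P >-> R} := HB.pack S (isMeasurableFun.Build _ _ _ _ _ mS).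
pose t := x / (2 * v).
have t0 : 0 < t by rewrite divr_gt0 ?mulr_gt0.
apply: (le_trans (chernoff S' x t0)).
rewrite (_ : - (x ^+ 2 / (4 * v)) = v * t ^+ 2 - t * x); last first.
  by rewrite /t; field; rewrite gt_eqF.
rewrite expRD EFinM lee_pmul2r ?lte_fin ?expR_gt0//.
apply: le_trans (mgfS t t0); rewrite /mmt_gen_fun unlock.
by under eq_integral do rewrite /= mulrC.
Qed.
Theorem proposition3p4 (R : realType) (a rho K1 K2 : R)
    (a_gt0 : 0 < a) (rho_ge0 : 0 <= rho) (rho_lt1 : rho < 1)
    (K1_ge1 : 1 <= K1) (K2_ge1 : 1 <= K2) :
  exists c : R, 0 < c /\
    forall (X Y : completeMetricType R)
      (d : measure_display) (Omega : measurableType d) (P : probability Omega R)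
      (X1 : {RV P >-> borel X}) (eps : nat -> {RV P >-> borel Y})
      (F : X * Y -> X) (C : R) (n : nat) (f : ('I_n -> X) -> R),
    separable_space X -> separable_space Y ->
    mutually_independent eps -> identically_distributed eps ->
    independent_of_family X1 (fun k => eps k.+1) ->
    measurable_fun [set: borel X * borel Y] (F : borel X * borel Y -> borel X) ->
    0 < C ->
    (forall x x' : X,
      ('E_P[fun w => mdist (F (x, eps 0%N w)) (F (x', eps 0%N w))]
        <= (rho * mdist x x')%:E)%E) ->
    (forall (x : X) (y y' : Y), mdist (F (x, y)) (F (x, y')) <= C * mdist y y') ->
    (1 <= n)%N ->
    (forall x x' : 'I_n -> X, `|f x - f x'| <= \sum_(i < n) mdist (x i) (x' i)) ->
    (\int[P]_w expeR (a%:E * mean_dist (distribution P X1) 1 (X1 w) ^+ 2)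
      <= K1%:E)%E ->
    (\int[P]_w expeR (a%:E * mean_dist (distribution P (eps 0%N)) C (eps 0%N w) ^+ 2)
      <= K2%:E)%E ->
    let Sn := centered P (fun w => f (fun i : 'I_n => chain F X1 eps i w)) in
    (forall t : R, 0 < t ->
      ('E_P[fun w => expR (t * Sn w)] <= (expR (n%:R * c * t ^+ 2))%:E)%E /\
      ('E_P[fun w => expR (- t * Sn w)] <= (expR (n%:R * c * t ^+ 2))%:E)%E) /\
    (forall x : R, 0 < x ->
      (P [set w | (x <= Sn w)%R] <= (expR (- (x ^+ 2 / (4 * n%:R * c))))%:E)%E /\
      (P [set w | (x <= - Sn w)%R] <= (expR (- (x ^+ 2 / (4 * n%:R * c))))%:E)%E).
Proof.
have kappa_ge1 : 1 <= (1 - rho)^-1 by rewrite invf_ge1 ?subr_gt0// gerBl.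
have kappa_gt0 : 0 < (1 - rho)^-1 by exact: lt_le_trans kappa_ge1.
pose K := K1 + K2; have K_ge1 : 1 <= K by rewrite /K; lra.
pose c := 2 * K * (1 - rho)^-1 ^+ 2 / a.
have c_gt0 : 0 < c.
  by rewrite divr_gt0// !mulr_gt0 ?exprn_gt0// (lt_le_trans ltr01).
exists c; split=> //.
move=> X Y d Omega P X1 eps F C [//|k] f sepX _ indep id X1indep mF C0 contract
  lip _ fL exp1 exp2 Sn.
have [mu1_fin mu1_exp] := exp_mean_dist_law ler01 a_gt0 exp1.
have [mu_fin mu_exp] := exp_mean_dist_law (ltW C0) a_gt0 exp2.
have K1K : (K1%:E <= K%:E)%E by rewrite lee_fin /K; lra.
have K2K : (K2%:E <= K%:E)%E by rewrite lee_fin /K; lra.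
have mu1_expK := le_trans mu1_exp K1K.
have mu_expK := le_trans mu_exp K2K.
pose g (x : nat -> X) := f (fun i => x i).
have gL : last_lipschitz rho k g.
  move=> x x'; apply: (le_trans (fL _ _)).
  by rewrite big_ord_recr/= lerD2l ler_peMl ?mdist_ge0.
have F_contract (x x' : X) : (\int[distribution P (eps 0%N)]_y
    (mdist (F (x, y)) (F (x', y)))%:E <= (rho * mdist x x')%:E)%E.
  have := contract x x'; rewrite unlock.
  rewrite ge0_integral_distribution// => [|y]; last by rewrite lee_fin mdist_ge0.
  apply/measurable_EFinP.
  exact: (measurable_mdist_lipschitz (ltW C0) (lip x) (lip x')).
have [m [im Em mgfm]] := chain_concentrated sepX indep id X1indep mF a_gt0
  rho_ge0 rho_lt1 (ltW C0) K_ge1 F_contract lip mu_fin mu_expK mu1_fin mu1_expK gL.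
have SnE w : Sn w = g (fun i => chain F X1 eps i w) - m.
  by rewrite /Sn /centered unlock Em.
have mS : measurable_fun setT Sn.
  rewrite (_ : Sn = fun w => g (fun i => chain F X1 eps i w) - m).
    apply: measurable_funB => //; apply/measurable_EFinP.
    exact: (measurable_int P im).
  exact/funext.
have mgfS t : (\int[P]_w (expR (t * Sn w))%:E <=
    (expR (k.+1%:R * c * t ^+ 2))%:E)%E.
  by under eq_integral do rewrite SnE; exact: mgfm.
have mgfNS t : (\int[P]_w (expR (t * - Sn w))%:E <=
    (expR (k.+1%:R * c * t ^+ 2))%:E)%E.
  under eq_integral do rewrite mulrN -mulNr.
  by rewrite -(sqrrN t); exact: mgfS.
have v_gt0 : 0 < k.+1%:R * c by rewrite mulr_gt0.
split=> [t t0|x x0].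
  rewrite unlock; split; first exact: mgfS.
  by rewrite -(sqrrN t); exact: mgfS.
rewrite -mulrA; split; apply: tail_le_of_mgf => // *.
exact: measurable_funN.
Qed.
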